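(* Let $m\in\mathbb{N}$ and $-1<\alpha<0$. For $k\in\mathbb{N}$, $$L_{m,m+k}^{\mathrm{III},\alpha}(x)=(m+k)\int_0^xL_{k-1}^{\alpha+1}(t)L_m^{-\alpha-1}(-t)\,dt+(m+1)\binom{k+\alpha}{k-1}\binom{m-\alpha-1}{m+1}.$$
   Context: $\mathbb{N}=\{1,2,\dots\}$. For real $r$ and integer $i\ge0$, $\binom{r}{i}=r(r-1)\cdots(r-i+1)/i!$. For $a\in\mathbb{R}$ and integer $n\ge0$ the classical Laguerre polynomial is $L_n^a(x)=\sum_{j=0}^n\binom{n+a}{n-j}\frac{(-x)^j}{j!}$; $L_n^a:=0$ for $n<0$. The Type III exceptional $X_m$-Laguerre polynomials are $L_{m,0}^{\mathrm{III},\alpha}(x)=1$ and, for $n\ge m+1$, $$L_{m,n}^{\mathrm{III},\alpha}(x)=xL_{n-m-2}^{\alpha+2}(x)L_m^{-\alpha-1}(-x)+(m+1)L_{n-m-1}^{\alpha+1}(x)L_{m+1}^{-\alpha-2}(-x).$$ *)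

(* Defs.v *)
From Stdlib Require Import Reals ZArith.
From Coquelicot Require Import Coquelicot.

Open Scope R_scope.

Fixpoint falling (r : R) (i : nat) : R :=
  match i with
  | O => 1
  | S i' => falling r i' * (r - INR i')
  end.

Definition gbinom (r : R) (i : nat) : R := falling r i / INR (fact i).

(* [sum_f_R0 f n] is the sum of [f j] for [0 <= j <= n], both ends included. *)
Definition laguerre_nat (n : nat) (a x : R) : R :=
  sum_f_R0
    (fun j => gbinom (INR n + a) (n - j) * ((- x) ^ j / INR (fact j))) n.

(* The degree is an integer, with value 0 in negative degree, so that index
   expressions such as [n - m - 2] are not truncated. *)
Definition laguerre (n : Z) (a x : R) : R :=
  if (n <? 0)%Z then 0 else laguerre_nat (Z.to_nat n) a x.

(* The Type III exceptional polynomials exist only in degrees [n = 0] and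
   [n >= m + 1]; for [1 <= n <= m] the expression below is 0, a junk value. *)
Definition xlaguerreIII (m n : nat) (alpha x : R) : R :=
  match n with
  | O => 1
  | S _ =>
      x * laguerre (Z.of_nat n - Z.of_nat m - 2) (alpha + 2) x
        * laguerre (Z.of_nat m) (- alpha - 1) (- x)
      + (INR m + 1) * laguerre (Z.of_nat n - Z.of_nat m - 1) (alpha + 1) x
        * laguerre (Z.of_nat m + 1) (- alpha - 2) (- x)
  end.

(* Main.v *)
Require Import Defs.
From Stdlib Require Import Reals ZArith Lra Lia.
From Coquelicot Require Import Coquelicot.

Open Scope R_scope.

(** The right-hand side of the claim is a primitive, so it suffices to
    differentiate the exceptional polynomial and to evaluate it at [0].  Put
    [a = alpha + 1], [u(x) = L_(k-1)^a(x)] and [w(x) = L_(m+1)^(-a-1)(-x)].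
    Since [(L_n^a)' = - L_(n-1)^(a+1)] ([is_derive_laguerre]), the exceptional
    polynomial of degree [m + k] is [F = - x u' w' + (m+1) u w].  Laguerre's
    differential equation ([laguerre_ode]) for [u] and for [w] reads

      [x u'' = - (a + 1 - x) u' - (k - 1) u]
      and [x w'' = (a - x) w' + (m + 1) w].

    When these are substituted into [F'], the terms in [u' w'] and in [u' w]
    cancel, which leaves [F' = (m + k) u w'], the integrand.  At [0] only
    [(m+1) u(0) w(0)] survives, and [L_n^a(0)] is the binomial coefficient of
    [n + a] over [n].

    The derivative rule and the differential equation are both read off the
    coefficients of [L_n^a], which satisfy the two-term recurrences
    [laguerre_coef_pred] and [laguerre_coef_succ]. *)

(** * Polynomials given by their coefficients *)

Definition poly_sum (c : nat -> R) (N : nat) (x : R) : R :=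
  sum_f_R0 (fun j => c j * x ^ j) N.

Definition deriv_coef (c : nat -> R) (j : nat) : R := INR (S j) * c (S j).

(** The derivative is summed up to the same bound [N] as the polynomial, hence
    the correction term; it disappears as soon as [c] vanishes beyond [N]. *)
Lemma is_derive_poly_sum (c : nat -> R) (N : nat) (x : R) :
  is_derive (poly_sum c N) x
    (poly_sum (deriv_coef c) N x - deriv_coef c N * x ^ N).
Proof.
  induction N as [|N IH].
  - unfold poly_sum; simpl.
    auto_derive; [easy | ring].
  - replace (poly_sum (deriv_coef c) (S N) x - deriv_coef c (S N) * x ^ S N)
      with (plus (poly_sum (deriv_coef c) N x - deriv_coef c N * x ^ N)
                 (deriv_coef c N * x ^ N))
      by (unfold poly_sum, plus; simpl; ring).
    apply (is_derive_plus (poly_sum c N) (fun y => c (S N) * y ^ S N));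
      [exact IH|].
    unfold deriv_coef.
    auto_derive; [easy|].
    change (c (S N) * (1 * (INR (S N) * x ^ N))
            = INR (S N) * c (S N) * x ^ N).
    ring.
Qed.

Lemma mul_poly_sum_deriv_coef (c : nat -> R) (N : nat) (x : R) :
  x * poly_sum (deriv_coef c) N x =
    poly_sum (fun j => INR j * c j) N x + INR (S N) * c (S N) * x ^ S N.
Proof.
  unfold poly_sum.
  induction N as [|N IH].
  - unfold deriv_coef; simpl; ring.
  - rewrite !tech5, Rmult_plus_distr_l, IH.
    unfold deriv_coef.
    rewrite <- (tech_pow_Rmult x (S N)); ring.
Qed.

Lemma poly_sum_eq (c d : nat -> R) (N : nat) (x : R) :
  (forall j, c j = d j) -> poly_sum c N x = poly_sum d N x.
Proof.
  intros H; apply sum_eq; intros j _; now rewrite H.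
Qed.

Lemma poly_sum_plus (c d : nat -> R) (N : nat) (x : R) :
  poly_sum c N x + poly_sum d N x = poly_sum (fun j => c j + d j) N x.
Proof.
  unfold poly_sum; rewrite <- plus_sum.
  apply sum_eq; intros j _; ring.
Qed.

Lemma poly_sum_scal (r : R) (c : nat -> R) (N : nat) (x : R) :
  r * poly_sum c N x = poly_sum (fun j => r * c j) N x.
Proof.
  unfold poly_sum; rewrite scal_sum.
  apply sum_eq; intros j _; ring.
Qed.

Lemma poly_sum_zero (N : nat) (x : R) : poly_sum (fun _ => 0) N x = 0.
Proof.
  induction N as [|N IH]; unfold poly_sum in *; simpl in *; [ring|].
  rewrite IH; ring.
Qed.

(** * Coefficients of the Laguerre polynomials *)

Lemma gbinom_succ (r : R) (i : nat) :
  INR (S i) * gbinom r (S i) = (r - INR i) * gbinom r i.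
Proof.
  unfold gbinom; rewrite fact_simpl, mult_INR; simpl falling.
  field; split; [apply INR_fact_neq_0 | apply not_0_INR; lia].
Qed.

(** The degree is an integer so that the recurrences below need no side
    condition, even when lowering the degree makes it negative. *)
Definition laguerre_coef (n : Z) (a : R) (j : nat) : R :=
  if (n <? Z.of_nat j)%Z then 0
  else gbinom (IZR n + a) (Z.to_nat (n - Z.of_nat j))
       * ((-1) ^ j / INR (fact j)).

Lemma laguerre_coef_above (n : Z) (a : R) (j : nat) :
  (n < Z.of_nat j)%Z -> laguerre_coef n a j = 0.
Proof.
  intros H; unfold laguerre_coef.
  now rewrite (proj2 (Z.ltb_lt _ _) H).
Qed.

(** Neither [n + a] nor [n - j] changes when [n], [a], [j] become [n - 1],
    [a + 1], [j - 1], so only the factor [(-1)^j / j!] has to be compared. *)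
Lemma laguerre_coef_pred (n : Z) (a : R) (j : nat) :
  laguerre_coef (n - 1) (a + 1) j = - deriv_coef (laguerre_coef n a) j.
Proof.
  unfold deriv_coef, laguerre_coef.
  destruct (Z.ltb_spec (n - 1) (Z.of_nat j));
    destruct (Z.ltb_spec n (Z.of_nat (S j))); try lia; [ring|].
  replace (n - 1 - Z.of_nat j)%Z with (n - Z.of_nat (S j))%Z by lia.
  replace (IZR (n - 1) + (a + 1)) with (IZR n + a)
    by (rewrite minus_IZR; ring).
  rewrite fact_simpl, mult_INR; simpl pow.
  field; split; [apply INR_fact_neq_0 | apply not_0_INR; lia].
Qed.

(** This is the absorption identity for binomial coefficients; as a statement
    about power series coefficients it is Laguerre's differential equation. *)
Lemma laguerre_coef_succ (n : Z) (a : R) (j : nat) :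
  (a + INR j + 1) * deriv_coef (laguerre_coef n a) j
  = (INR j - IZR n) * laguerre_coef n a j.
Proof.
  destruct (Z.lt_trichotomy n (Z.of_nat j)) as [H | [H | H]].
  - unfold deriv_coef; rewrite !laguerre_coef_above by lia; ring.
  - unfold deriv_coef; rewrite (laguerre_coef_above n a (S j)) by lia.
    rewrite H, <- INR_IZR_INZ; ring.
  - unfold deriv_coef, laguerre_coef.
    destruct (Z.ltb_spec n (Z.of_nat (S j))); [lia|].
    destruct (Z.ltb_spec n (Z.of_nat j)); [lia|].
    set (i := Z.to_nat (n - Z.of_nat (S j))).
    replace (Z.to_nat (n - Z.of_nat j)) with (S i) by lia.
    assert (Hn : IZR n = INR (S i) + INR j)
      by (rewrite <- plus_INR, INR_IZR_INZ; f_equal; lia).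
    pose proof (gbinom_succ (IZR n + a) i) as Habs.
    replace (IZR n + a - INR i) with (a + INR j + 1) in Habs
      by (rewrite Hn, S_INR; ring).
    replace (INR j - IZR n) with (- INR (S i)) by (rewrite Hn; ring).
    rewrite fact_simpl, mult_INR; simpl pow.
    transitivity
      (- ((a + INR j + 1) * gbinom (IZR n + a) i) * ((-1) ^ j / INR (fact j)));
      [|rewrite <- Habs; ring].
    field; split; [apply INR_fact_neq_0 | apply not_0_INR; lia].
Qed.

(** The bound [N] is left free so that polynomials of different degrees can be
    written as sums over the same range. *)
Lemma laguerre_poly_sum (n : Z) (a x : R) (N : nat) :
  (n <= Z.of_nat N)%Z -> laguerre n a x = poly_sum (laguerre_coef n a) N x.
Proof.
  induction N as [|N IH]; intros HN.
  - unfold laguerre, poly_sum, laguerre_coef; simpl.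
    destruct (Z.ltb_spec n 0); [ring|].
    replace n with 0%Z by lia.
    unfold laguerre_nat; simpl; field.
  - destruct (Z.eq_dec n (Z.of_nat (S N))) as [-> | Hne].
    + unfold laguerre.
      destruct (Z.ltb_spec (Z.of_nat (S N)) 0); [lia|].
      rewrite Nat2Z.id.
      apply sum_eq; intros j Hj.
      unfold laguerre_coef.
      destruct (Z.ltb_spec (Z.of_nat (S N)) (Z.of_nat j)); [lia|].
      replace (Z.to_nat (Z.of_nat (S N) - Z.of_nat j)) with (S N - j)%nat
        by lia.
      rewrite <- INR_IZR_INZ.
      replace (- x) with (-1 * x) by ring.
      rewrite Rpow_mult_distr.
      field; apply INR_fact_neq_0.
    + rewrite IH by lia.
      unfold poly_sum; rewrite tech5.
      rewrite laguerre_coef_above by lia; ring.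
Qed.

(** * Analytic properties of the Laguerre polynomials *)

Lemma laguerre_at_0 (n : nat) (a : R) :
  laguerre (Z.of_nat n) a 0 = gbinom (INR n + a) n.
Proof.
  rewrite (laguerre_poly_sum _ _ _ n) by lia.
  assert (Hconst : forall c N, poly_sum c N 0 = c 0%nat).
  { intros c N; unfold poly_sum; induction N as [|N IH]; simpl in *;
      [|rewrite IH]; ring. }
  rewrite Hconst; unfold laguerre_coef.
  destruct (Z.ltb_spec (Z.of_nat n) (Z.of_nat 0)); [lia|].
  replace (Z.to_nat (Z.of_nat n - Z.of_nat 0)) with n by lia.
  rewrite <- INR_IZR_INZ; simpl; field.
Qed.

Lemma is_derive_laguerre (n : Z) (a x : R) :
  is_derive (laguerre n a) x (- laguerre (n - 1) (a + 1) x).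
Proof.
  set (N := Z.to_nat n).
  apply (is_derive_ext (poly_sum (laguerre_coef n a) N)).
  { intros t; symmetry; apply laguerre_poly_sum; lia. }
  rewrite (laguerre_poly_sum (n - 1) (a + 1) x N) by lia.
  replace (- poly_sum (laguerre_coef (n - 1) (a + 1)) N x)
    with (poly_sum (deriv_coef (laguerre_coef n a)) N x
          - deriv_coef (laguerre_coef n a) N * x ^ N).
  { apply is_derive_poly_sum. }
  unfold deriv_coef at 2; rewrite (laguerre_coef_above n a (S N)) by lia.
  rewrite (poly_sum_eq _ _ N x (laguerre_coef_pred n a)).
  replace (- poly_sum (fun j => - deriv_coef (laguerre_coef n a) j) N x)
    with (-1 * poly_sum (fun j => - deriv_coef (laguerre_coef n a) j) N x)
    by ring.
  rewrite poly_sum_scal, Rmult_0_r, Rmult_0_l, Rminus_0_r.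
  apply poly_sum_eq; intros j; ring.
Qed.

(** Laguerre's equation [x y'' + (a + 1 - x) y' + n y = 0] for [y = L_n^a],
    with the derivatives written as Laguerre polynomials. *)
Lemma laguerre_ode (n : Z) (a x : R) :
  x * laguerre (n - 1 - 1) (a + 1 + 1) x
  - (a + 1 - x) * laguerre (n - 1) (a + 1) x + IZR n * laguerre n a x = 0.
Proof.
  set (N := Z.to_nat n).
  rewrite (laguerre_poly_sum n a x N) by lia.
  rewrite (laguerre_poly_sum (n - 1) (a + 1) x N) by lia.
  rewrite (laguerre_poly_sum (n - 1 - 1) (a + 1 + 1) x N) by lia.
  set (c := laguerre_coef n a).
  set (d := laguerre_coef (n - 1) (a + 1)).
  assert (Hd : forall j, d j = - deriv_coef c j)
    by (intros j; apply laguerre_coef_pred).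
  (* Multiplication by [x] shifts the two derivatives back by one index, so
     that everything can be compared coefficient by coefficient. *)
  assert (Hx2 : x * poly_sum (laguerre_coef (n - 1 - 1) (a + 1 + 1)) N x
                = poly_sum (fun j => - (INR j * d j)) N x).
  { rewrite (poly_sum_eq _ (fun j => -1 * deriv_coef d j))
      by (intros j; rewrite laguerre_coef_pred; fold d; ring).
    rewrite <- poly_sum_scal.
    replace (x * (-1 * poly_sum (deriv_coef d) N x))
      with (-1 * (x * poly_sum (deriv_coef d) N x)) by ring.
    rewrite mul_poly_sum_deriv_coef.
    unfold d at 2; rewrite laguerre_coef_above by lia.
    rewrite Rmult_0_r, Rmult_0_l, Rplus_0_r, poly_sum_scal.
    apply poly_sum_eq; intros j; ring. }
  assert (Hx1 : x * poly_sum d N x = poly_sum (fun j => - (INR j * c j)) N x).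
  { rewrite (poly_sum_eq _ (fun j => -1 * deriv_coef c j))
      by (intros j; rewrite Hd; ring).
    rewrite <- poly_sum_scal.
    replace (x * (-1 * poly_sum (deriv_coef c) N x))
      with (-1 * (x * poly_sum (deriv_coef c) N x)) by ring.
    rewrite mul_poly_sum_deriv_coef.
    unfold c at 2; rewrite laguerre_coef_above by lia.
    rewrite Rmult_0_r, Rmult_0_l, Rplus_0_r, poly_sum_scal.
    apply poly_sum_eq; intros j; ring. }
  rewrite Hx2.
  replace (poly_sum (fun j => - (INR j * d j)) N x
           - (a + 1 - x) * poly_sum d N x + IZR n * poly_sum c N x)
    with (poly_sum (fun j => - (INR j * d j)) N x
          + - (a + 1) * poly_sum d N x + x * poly_sum d N x
          + IZR n * poly_sum c N x) by ring.
  rewrite Hx1, !poly_sum_scal, !poly_sum_plus.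
  rewrite <- (poly_sum_zero N x).
  apply poly_sum_eq; intros j; rewrite Hd.
  pose proof (laguerre_coef_succ n a j) as Hrec; fold c in Hrec; lra.
Qed.

Lemma is_derive_laguerre_opp (n : Z) (a x : R) :
  is_derive (fun t => laguerre n a (- t)) x (laguerre (n - 1) (a + 1) (- x)).
Proof.
  replace (laguerre (n - 1) (a + 1) (- x))
    with (scal (-1) (- laguerre (n - 1) (a + 1) (- x)))
    by (unfold scal; simpl; unfold mult; simpl; ring).
  apply (is_derive_comp (laguerre n a) Ropp).
  - apply is_derive_laguerre.
  - auto_derive; [easy | ring].
Qed.

(** * The exceptional polynomial as a primitive *)

(** The combination below is [- x u' w' + p u w] for [u = L_n^a(x)] and
    [w = L_p^(-a-1)(-x)].  The parameters of [u] and [w] are opposite up to a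
    shift, and this is what makes the [u' w'] terms of the derivative cancel. *)
Lemma is_derive_laguerre_bilinear (n p : Z) (a x : R) :
  is_derive
    (fun t => t * laguerre (n - 1) (a + 1) t * laguerre (p - 1) (- a) (- t)
              + IZR p * laguerre n a t * laguerre p (- a - 1) (- t)) x
    (IZR (n + p) * (laguerre n a x * laguerre (p - 1) (- a) (- x))).
Proof.
  pose proof (is_derive_laguerre n a x) as Du.
  pose proof (is_derive_laguerre (n - 1) (a + 1) x) as Du1.
  pose proof (is_derive_laguerre_opp p (- a - 1) x) as Dw.
  pose proof (is_derive_laguerre_opp (p - 1) (- a) x) as Dw1.
  pose proof (laguerre_ode n a x) as Ou.
  pose proof (laguerre_ode p (- a - 1) (- x)) as Ow.
  replace (- a - 1 + 1) with (- a) in Dw, Ow by ring.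
  (* The four factors enter only through their derivatives and the two
     differential equations, so they are now made opaque. *)
  set (u := laguerre n a) in *.
  set (u1 := laguerre (n - 1) (a + 1)) in *.
  set (w := fun t => laguerre p (- a - 1) (- t)) in *.
  set (w1 := fun t => laguerre (p - 1) (- a) (- t)) in *.
  change (laguerre p (- a - 1) (- x)) with (w x) in Ow.
  change (laguerre (p - 1) (- a) (- x)) with (w1 x) in *.
  change (is_derive w x (w1 x)) in Dw.
  change (is_derive w1 x (laguerre (p - 1 - 1) (- a + 1) (- x))) in Dw1.
  change (is_derive (fun t => t * u1 t * w1 t + IZR p * u t * w t) x
            (IZR (n + p) * (u x * w1 x))).
  set (u2 := laguerre (n - 1 - 1) (a + 1 + 1) x) in *.
  set (w2 := laguerre (p - 1 - 1) (- a + 1) (- x)) in *.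
  clearbody u u1 w w1 u2 w2.
  auto_derive.
  - repeat apply conj; try exact I; eexists; eassumption.
  - replace (Derive (fun t => u t) x) with (- u1 x)
      by (symmetry; now apply is_derive_unique).
    replace (Derive (fun t => u1 t) x) with (- u2)
      by (symmetry; now apply is_derive_unique).
    replace (Derive (fun t => w t) x) with (w1 x)
      by (symmetry; now apply is_derive_unique).
    replace (Derive (fun t => w1 t) x) with w2
      by (symmetry; now apply is_derive_unique).
    rewrite plus_IZR.
    (* The difference of the two sides is [- w1 x] times the left side of [Ou]
       minus [u1 x] times the left side of [Ow]. *)
    apply Rminus_diag_uniq.
    transitivity
      (- w1 x * (x * u2 - (a + 1 - x) * u1 x + IZR n * u x)
       - u1 x * (- x * w2 - (- a - - x) * w1 x + IZR p * w x)).
    + ring.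
    + rewrite Ou, Ow; ring.
Qed.

Theorem theorem5p2 (m : nat) (hm : (1 <= m)%nat) (alpha : R)
    (halpha : -1 < alpha < 0) (k : nat) (hk : (1 <= k)%nat) (x : R) :
  xlaguerreIII m (m + k) alpha x =
    (INR m + INR k) *
      RInt (fun t => laguerre (Z.of_nat k - 1) (alpha + 1) t
                     * laguerre (Z.of_nat m) (- alpha - 1) (- t)) 0 x
    + (INR m + 1) * gbinom (INR k + alpha) (k - 1)
      * gbinom (INR m - alpha - 1) (m + 1).
Proof.
  set (f := fun t => laguerre (Z.of_nat k - 1) (alpha + 1) t
                     * laguerre (Z.of_nat m) (- alpha - 1) (- t)).
  assert (HF : forall t,
    is_derive (xlaguerreIII m (m + k) alpha) t ((INR m + INR k) * f t)).
  { intros t.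
    pose proof (is_derive_laguerre_bilinear
                  (Z.of_nat k - 1) (Z.of_nat m + 1) (alpha + 1) t) as H.
    replace (IZR (Z.of_nat k - 1 + (Z.of_nat m + 1))) with (INR m + INR k) in H
      by (rewrite <- plus_INR, INR_IZR_INZ; f_equal; lia).
    replace (Z.of_nat m + 1 - 1)%Z with (Z.of_nat m) in H by lia.
    replace (- (alpha + 1)) with (- alpha - 1) in H by ring.
    refine (is_derive_ext _ _ _ _ _ H); intros s.
    unfold xlaguerreIII.
    destruct (m + k)%nat as [|q] eqn:Hq; [lia|].
    replace (Z.of_nat (S q) - Z.of_nat m - 2)%Z
      with (Z.of_nat k - 1 - 1)%Z by lia.
    replace (Z.of_nat (S q) - Z.of_nat m - 1)%Z
      with (Z.of_nat k - 1)%Z by lia.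
    replace (alpha + 1 + 1) with (alpha + 2) by ring.
    replace (- alpha - 1 - 1) with (- alpha - 2) by ring.
    rewrite plus_IZR, <- INR_IZR_INZ; reflexivity. }
  assert (Hf : forall t, continuous f t).
  { intros t; apply (continuous_mult (K := R_AbsRing)).
    - apply (ex_derive_continuous (V := R_NormedModule)).
      eexists; apply is_derive_laguerre.
    - apply (ex_derive_continuous (V := R_NormedModule)).
      eexists; apply is_derive_laguerre_opp. }
  assert (H0 : xlaguerreIII m (m + k) alpha 0
               = (INR m + 1) * gbinom (INR k + alpha) (k - 1)
                 * gbinom (INR m - alpha - 1) (m + 1)).
  { unfold xlaguerreIII.
    destruct (m + k)%nat as [|q] eqn:Hq; [lia|].
    replace (Z.of_nat (S q) - Z.of_nat m - 1)%Z
      with (Z.of_nat (k - 1)) by lia.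
    replace (Z.of_nat m + 1)%Z with (Z.of_nat (m + 1)) by lia.
    rewrite Ropp_0, !laguerre_at_0, minus_INR, plus_INR by lia.
    simpl INR.
    replace (INR k - 1 + (alpha + 1)) with (INR k + alpha) by ring.
    replace (INR m + 1 + (- alpha - 2)) with (INR m - alpha - 1) by ring.
    ring. }
  assert (HI : is_RInt (fun t => (INR m + INR k) * f t) 0 x
                 (xlaguerreIII m (m + k) alpha x
                  - xlaguerreIII m (m + k) alpha 0)).
  { apply (is_RInt_derive (V := R_CompleteNormedModule)
             (xlaguerreIII m (m + k) alpha)).
    - intros t _; apply HF.
    - intros t _; apply (continuous_mult (K := R_AbsRing));
        [apply continuous_const | apply Hf]. }
  assert (Hex : ex_RInt f 0 x)
    by (apply (ex_RInt_continuous (V := R_CompleteNormedModule));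
        intros t _; apply Hf).
  pose proof (RInt_scal f 0 x (INR m + INR k) Hex) as Hs.
  pose proof (is_RInt_unique _ _ _ _ HI) as Hu.
  unfold scal in Hs; simpl in Hs; unfold mult in Hs; simpl in Hs.
  rewrite <- H0, <- Hs, Hu; ring.
Qed.
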